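(* Let $K:X\times X\to\mathbb C$ be an admissible scalar-valued kernel and let $\mathbb A\in\mathcal L(\mathcal B_p,\mathcal B_q)$ be an invertible operator. Then $\mathbf K:X\times X\to\mathcal L(\mathcal B_p,\mathcal B_q)$, $\mathbf K(x,x')=K(x,x')\mathbb A$, is an admissible (matrix-valued) kernel.
   Context: Let $p\in[1,+\infty]$ and $1/p+1/q=1$. $\mathcal B_p$ denotes the complex sequence space $\ell^2$ if $p=2$ and $(\mathbb C^n,\|\cdot\|_p)$ (fixed $n$) if $p\ne2$; $\mathcal B_q$ is defined in the same way from $q$. $\mathcal L(\mathcal B_p,\mathcal B_q)$ is the space of bounded linear operators with the operator norm; $\mathbb A$ invertible means that it has a two-sided inverse in $\mathcal L(\mathcal B_q,\mathcal B_p)$. $X$ is a nonempty set. For $v=(v_1,\dots,v_m)\in\mathcal B_p^m$, $\|v\|_{p,1}=\sum_i\|v_i\|_p$. For pairwise distinct $\mathbf x=\{x_1,\dots,x_m\}\subseteq X$, $\mathbf K[\mathbf x]$ is the $m\times m$ operator matrix with $(k,i)$ entry $\mathbf K(x_i,x_k)$, and $\mathbf K_{\mathbf x}(x)=(\mathbf K(x,x_i):i=1,\dots,m)^T$, viewed as an operator $\mathcal B_p\to\mathcal B_q^m$; the same notation is used for scalar kernels, with scalar entries. An operator-valued kernel $\mathbf K:X\times X\to\mathcal L(\mathcal B_p,\mathcal B_q)$ is admissible if: (A1) for all $m$ and pairwise distinct $\mathbf x=\{x_1,\dots,x_m\}$, $\mathbf K[\mathbf x]:\mathcal B_p^m\to\mathcal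 B_q^m$ has a two-sided inverse $\mathbf K[\mathbf x]^{-1}$ with entries in $\mathcal L(\mathcal B_q,\mathcal B_p)$. (A2) there is $\kappa>0$ with $\|\mathbf K(x,x')\|\le\kappa$ for all $x,x'\in X$. (A3) for any finite or countably infinite family of pairwise distinct $x_i\in X$ and $c_i\in\mathcal B_p$ with $\sum_i\|c_i\|_p<\infty$, if $\sum_i\mathbf K(x_i,x)c_i=0$ for all $x\in X$, then all $c_i=0$. (A4) for all $m$ and pairwise distinct $x_1,\dots,x_{m+1}\in X$, with $\mathbf x=\{x_1,\dots,x_m\}$, $\sup_{c\in\mathcal B_p,c\ne0}\|\mathbf K[\mathbf x]^{-1}\mathbf K_{\mathbf x}(x_{m+1})c\|_{p,1}/\|c\|_p\le1$. A scalar kernel $K:X\times X\to\mathbb C$ is admissible if: (A1$'$) $K[\mathbf x]$ is an invertible matrix for all finite sets $\mathbf x$ of pairwise distinct points; (A2$'$) $K$ is bounded; (A3$'$) for any finite or countably infinite family of pairwise distinct $x_i\in X$ and scalars $c_i$ with $\sum_i|c_i|<\infty$, $\sum_ic_iK(x_i,x)=0$ for all $x\in X$ implies all $c_i=0$; (A4$'$) for all $m$ and pairwise distinct $x_1,\dots,x_{m+1}\in X$, with $\mathbf x=\{x_1,\dots,x_m\}$, $\|K[\mathbf x]^{-1}K_{\mathbf x}(x_{m+1})\|_1\le1$ ($\ell^1$-norm on $\mathbb C^m$). *)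

(* Defs.v *)
From HB Require Import structures.
From mathcomp Require Import all_boot all_order all_algebra.
From mathcomp Require Import complex.
From mathcomp Require Import all_classical all_reals all_analysis.

Set Implicit Arguments.
Unset Strict Implicit.
Unset Printing Implicit Defensive.

From mathcomp Require Import ring lra.

Import Order.TTheory GRing.Theory Num.Theory.
Import ComplexField.Normc.
Import numFieldNormedType.Exports.

Local Open Scope classical_set_scope.
Local Open Scope complex_scope.
Local Open Scope ring_scope.

Section lp_norm.
Context {R : realType} {I : choiceType}.
Local Open Scope ereal_scope.

(* The singleton 0 in the case p = +oo only matters when I is empty. *)
Definition lp_norm (p : \bar R) (f : I -> R[i]) : \bar R :=
  match p with
  | r%:E => (\esum_(i in [set: I]) ((normc (f i)) `^ r)%:E) `^ (r^-1)
  | +oo => ereal_sup ([set 0] `|` [set (normc (f i))%:E | i in [set: I]])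
  | -oo => 0
  end.

Lemma normc_ge0 (z : R[i]) : (0 <= normc z)%R.
Proof. by case: z => a b; exact: sqrtr_ge0. Qed.

Lemma lp_norm_ge0 p f : 0 <= lp_norm p f.
Proof.
case: p => [r| |] //=; first exact: poweR_ge0.
by apply: ereal_sup_ubound; left.
Qed.

Lemma esum_powR_ge0 r (f : I -> R[i]) :
  0 <= \esum_(i in [set: I]) ((normc (f i)) `^ r)%:E.
Proof. by apply: esum_ge0 => i _; rewrite lee_fin powR_ge0. Qed.

Lemma le_poweR (x y : \bar R) r :
  (0 <= r)%R -> 0 <= x -> x <= y -> x `^ r <= y `^ r.
Proof.
move=> r0 x0 xy; apply: gt0_ler_poweR => //.
  by rewrite in_itv /= x0 leey.
by rewrite in_itv /= (le_trans x0 xy) leey.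
Qed.

Lemma poweRVK (x : \bar R) r : (0 < r)%R -> 0 <= x -> (x `^ r^-1) `^ r = x.
Proof. by move=> r0 x0; rewrite -poweRrM mulVf ?lt0r_neq0// poweRe1. Qed.

Lemma poweRKV (x : \bar R) r : (0 < r)%R -> 0 <= x -> (x `^ r) `^ r^-1 = x.
Proof. by move=> r0 x0; rewrite -poweRrM mulfV ?lt0r_neq0// poweRe1. Qed.

Lemma lp_norm_le_sum r f M : (0 < r)%R -> (0 <= M)%R ->
  (lp_norm r%:E f <= M%:E) =
  (\esum_(i in [set: I]) ((normc (f i)) `^ r)%:E <= (M `^ r)%:E).
Proof.
move=> r0 M0 /=; set S := \esum_(_ in _) _.
have S0 : 0 <= S by exact: esum_powR_ge0.
have M0' : 0 <= M%:E by rewrite lee_fin.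
apply/idP/idP => H.
  by rewrite -poweR_EFin -[leLHS](poweRVK r0 S0) le_poweR ?poweR_ge0// ltW.
by rewrite -[leRHS](poweRKV r0 M0') le_poweR// invr_ge0 ltW.
Qed.

Lemma le_lp_norm p f i : 1 <= p -> (normc (f i))%:E <= lp_norm p f.
Proof.
case: p => [r| |] //= p1; last first.
  by apply: ereal_sup_ubound; right; exists i.
rewrite lee_fin in p1.
have r0 : (0 < r)%R := lt_le_trans ltr01 p1.
have f0 : 0 <= (normc (f i))%:E by rewrite lee_fin normc_ge0.
rewrite -[leLHS](poweRKV r0 f0) le_poweR ?poweR_ge0 ?invr_ge0 ?(ltW r0)//.
apply: esum_ge; exists [set i]; first by split; [exact: finite_set1|].
by rewrite fsbig_set1.
Qed.

Lemma lp_norm_eq0 p f : 1 <= p -> lp_norm p f = 0 -> f = fun=> 0%R.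
Proof.
move=> p1 f0; apply/funext => i; apply: eq0_normc; apply/eqP.
rewrite eq_le normc_ge0 andbT; have := le_lp_norm f i p1.
by rewrite f0 lee_fin.
Qed.

Lemma lp_norm0 p : 1 <= p -> lp_norm p (fun=> 0%R) = 0.
Proof.
move=> p1; apply/eqP; rewrite eq_le lp_norm_ge0 andbT /lp_norm.
case: p p1 => [r| |] // p1; rewrite normc0.
  rewrite lee_fin in p1; have r0 : (0 < r)%R := lt_le_trans ltr01 p1.
  by rewrite esum1 ?poweR0r ?invr_neq0 ?lt0r_neq0// => i _; rewrite powR0// lt0r_neq0.
by apply: ge_ereal_sup => _ [->|[i _ <-]].
Qed.

Lemma lp_normN p f : lp_norm p (fun i => - f i)%R = lp_norm p f.
Proof.
case: p => [r| |] //=; first by congr (_ `^ _); apply: eq_esum => i _; rewrite normcN.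
by congr (ereal_sup (_ `|` _)); apply: eq_imagel => i _; rewrite normcN.
Qed.

Lemma le_esumZ (a : I -> R) (k : R) (S : R) : (0 <= k)%R ->
  (forall i, 0 <= a i)%R -> \esum_(i in [set: I]) (a i)%:E <= S%:E ->
  \esum_(i in [set: I]) (k * a i)%:E <= (k * S)%:E.
Proof.
move=> k0 a0 aS; apply: ge_ereal_sup => _ [F [Ff _] <-].
under eq_fsbigr do rewrite EFinM.
rewrite -ge0_mule_fsumr; last by move=> i; rewrite lee_fin.
rewrite EFinM lee_wpmul2l ?lee_fin//; apply: le_trans aS.
by apply: ereal_sup_ubound; exists F.
Qed.

Lemma lp_normZ_le p k f M : 1 <= p -> (0 <= M)%R -> lp_norm p f <= M%:E ->
  lp_norm p (fun i => k * f i)%R <= (normc k * M)%:E.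
Proof.
case: p => [r| |] //= p1 M0.
  rewrite lee_fin in p1; have r0 : (0 < r)%R := lt_le_trans ltr01 p1.
  rewrite -!/(lp_norm r%:E _) !lp_norm_le_sum ?mulr_ge0 ?normc_ge0// => fM.
  rewrite powRM ?normc_ge0//.
  under eq_esum do rewrite normcM powRM ?normc_ge0//.
  by apply: le_esumZ => // *; rewrite powR_ge0.
move=> fM; apply: ge_ereal_sup => _ [->|[i _ <-]].
  by rewrite lee_fin mulr_ge0 ?normc_ge0.
rewrite normcM lee_fin ler_wpM2l ?normc_ge0// -lee_fin; apply: le_trans fM.
by apply: ereal_sup_ubound; right; exists i.
Qed.

Lemma convex_powR_le (r a b x y : R) : (1 <= r)%R -> (0 < a)%R -> (0 < b)%R ->
  (0 <= x)%R -> (0 <= y)%R ->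
  ((x + y) `^ r <=
    (a + b) `^ r * (a / (a + b)) * (a `^ r)^-1 * x `^ r +
    (a + b) `^ r * (b / (a + b)) * (b `^ r)^-1 * y `^ r)%R.
Proof.
move=> r1 a0 b0 x0 y0.
have ab0 : (0 < a + b)%R by rewrite addr_gt0.
have t0 : (0 <= a / (a + b))%R by rewrite divr_ge0 ?ltW.
have t1 : (a / (a + b) <= 1)%R by rewrite ler_pdivrMr// mul1r lerDl ltW.
have := @convex_powR R r r1 (Itv01 t0 t1) (x / a)%R (y / b)%R.
rewrite !inE /= !in_itv /= !andbT !divr_ge0 ?(ltW a0) ?(ltW b0)//.
move=> /(_ isT isT).
rewrite [X in ((X `^ _)%R <= _)%R -> _]convRE [X in (_ <= X)%R -> _]convRE /=.
rewrite /unstable.onem.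
have -> : (1 - a / (a + b) = b / (a + b))%R by field; exact: lt0r_neq0.
have -> : (a / (a + b) * (x / a) + b / (a + b) * (y / b) = (x + y) / (a + b))%R.
  by field; rewrite !lt0r_neq0.
have powRV c : (0 < c)%R -> (c^-1 `^ r = (c `^ r)^-1)%R.
  by move=> c0; rewrite -(powR_inv1 (ltW c0)) -powRrM mulN1r powRN.
rewrite !powRM ?invr_ge0 ?addr_ge0 ?(ltW a0) ?(ltW b0)//.
rewrite !powRV// ler_pdivrMr ?powR_gt0// => /le_trans; apply.
by rewrite le_eqVlt; apply/orP; left; apply/eqP; ring.
Qed.

Lemma le_lp_normD p f g a b : 1 <= p -> (0 < a)%R -> (0 < b)%R ->
  lp_norm p f <= a%:E -> lp_norm p g <= b%:E ->
  lp_norm p (fun i => f i + g i)%R <= (a + b)%:E.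
Proof.
case: p => [r| |] // p1 a0 b0; last first.
  move=> /= fa gb; apply: ge_ereal_sup => _ [->|[i _ <-]].
    by rewrite lee_fin addr_ge0// ltW.
  rewrite lee_fin; apply: le_trans (le_normcD _ _) _; apply: lerD.
    by rewrite -lee_fin; apply: le_trans fa; exact: (@le_lp_norm +oo).
  by rewrite -lee_fin; apply: le_trans gb; exact: (@le_lp_norm +oo).
rewrite lee_fin in p1; have r0 : (0 < r)%R := lt_le_trans ltr01 p1.
have ab0 : (0 < a + b)%R by rewrite addr_gt0.
rewrite !lp_norm_le_sum ?(ltW a0) ?(ltW b0) ?(ltW ab0)// => fa gb.
pose u := ((a + b) `^ r * (a / (a + b)) * (a `^ r)^-1)%R.
pose v := ((a + b) `^ r * (b / (a + b)) * (b `^ r)^-1)%R.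
have u0 : (0 <= u)%R by rewrite !mulr_ge0 ?invr_ge0 ?powR_ge0 ?(ltW ab0) ?(ltW a0).
have v0 : (0 <= v)%R by rewrite !mulr_ge0 ?invr_ge0 ?powR_ge0 ?(ltW ab0) ?(ltW b0).
apply: (@le_trans _ _ (\esum_(i in [set: I])
    ((u * normc (f i) `^ r)%:E + (v * normc (g i) `^ r)%:E))).
  apply: le_esum => i _; rewrite -EFinD lee_fin.
  apply: le_trans (convex_powR_le p1 a0 b0 (normc_ge0 _) (normc_ge0 _)).
  by apply: ge0_ler_powR; rewrite ?nnegrE ?addr_ge0 ?normc_ge0 ?(ltW r0) ?le_normcD.
rewrite esumD; last 2 first.
- by move=> i _; rewrite lee_fin mulr_ge0 ?powR_ge0.
- by move=> i _; rewrite lee_fin mulr_ge0 ?powR_ge0.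
have -> : ((a + b) `^ r = u * a `^ r + v * b `^ r)%R.
  rewrite /u /v; have := lt0r_neq0 (powR_gt0 r a0).
  have := lt0r_neq0 (powR_gt0 r b0).
  by move=> ? ?; field; do ?[apply/andP; split=> //]; exact: lt0r_neq0.
by rewrite EFinD leeD// le_esumZ// => i; exact: powR_ge0.
Qed.

Lemma lp_normD p f g : 1 <= p ->
  lp_norm p (fun i => f i + g i)%R <= lp_norm p f + lp_norm p g.
Proof.
move=> p1; have f0 := lp_norm_ge0 p f; have g0 := lp_norm_ge0 p g.
case Ef : (lp_norm p f) f0 => [a| |] // f0; last by rewrite addye ?leey// gt_eqF// (lt_le_trans _ g0).
case Eg : (lp_norm p g) g0 => [b| |] // g0; last by rewrite addey ?leey.
apply/lee_addgt0Pr => e e0; rewrite lee_fin in f0; rewrite lee_fin in g0.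
have -> : a%:E + b%:E + e%:E = ((a + e / 2) + (b + e / 2))%:E.
  by rewrite -!EFinD; congr EFin; field.
by apply: le_lp_normD; rewrite ?ltr_wpDl ?divr_gt0 ?Ef ?Eg ?lee_fin ?lerDl ?divr_ge0 ?(ltW e0).
Qed.

End lp_norm.

Section ell.
Context (R : realType) (p : \bar R).

Definition mem_ell (I : choiceType) : {pred (I -> R[i])} :=
  [pred f | (lp_norm p f < +oo)%E].

Record ell (p1 : (1 <= p)%E) (I : choiceType) : Type :=
  Ell { ell_fun :> I -> R[i] ; ell_funP : ell_fun \in @mem_ell I }.

End ell.

Section ell_theory.
Context (R : realType) (p : \bar R) (p1 : (1 <= p)%E) (I : choiceType).
Local Notation ty := (ell p1 I).

HB.instance Definition _ := [isSub of ty for @ell_fun R p p1 I].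
HB.instance Definition _ := [Choice of ty by <:].

Lemma mem_ell_submod_closed : submod_closed (@mem_ell R p I).
Proof.
split; first by rewrite inE [X in (X < _)%E](lp_norm0 p1) ltry.
move=> k f g; rewrite !inE => fp gp.
apply: le_lt_trans (@lp_normD R I p (k *: f) g p1) _.
apply: lte_add_pinfty => //.
have fM : (lp_norm p f <= (fine (lp_norm p f))%:E)%E.
  by rewrite fineK// ge0_fin_numE ?lp_norm_ge0.
have M0 : 0 <= fine (lp_norm p f) by rewrite fine_ge0 ?lp_norm_ge0.
exact: le_lt_trans (lp_normZ_le k p1 M0 fM) (ltry _).
Qed.

HB.instance Definition _ :=
  GRing.isSubmodClosed.Build R[i] (I -> R[i]) (@mem_ell R p I)
    mem_ell_submod_closed.

HB.instance Definition _ := [SubChoice_isSubLmodule of ty by <:].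

Definition ell_norm (f : ty) : R := fine (lp_norm p f).

Lemma ell_normE (f : ty) : (ell_norm f)%:E = lp_norm p f.
Proof. by rewrite fineK// ge0_fin_numE ?lp_norm_ge0//; exact: (ell_funP f). Qed.

Lemma ell_normD (f g : ty) : ell_norm (f + g) <= ell_norm f + ell_norm g.
Proof. by rewrite -lee_fin EFinD !ell_normE; exact: lp_normD. Qed.

Lemma ell_norm0_eq0 (f : ty) : ell_norm f = 0 -> f = 0.
Proof.
move=> f0; apply/val_inj; apply: (lp_norm_eq0 p1).
by rewrite -[LHS]ell_normE f0.
Qed.

Lemma ell_normZ k (f : ty) : ell_norm (k *: f) = normc k * ell_norm f.
Proof.
have N0 (h : ty) : 0 <= ell_norm h by rewrite fine_ge0 ?lp_norm_ge0.
have le_Z l (h : ty) : ell_norm (l *: h) <= normc l * ell_norm h.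
  by rewrite -lee_fin ell_normE; apply: lp_normZ_le; rewrite ?N0// ell_normE.
apply/eqP; rewrite eq_le le_Z /=.
have [->|k0] := eqVneq k 0; first by rewrite [normc 0]normc0 mul0r N0.
have nk0 : 0 < normc k.
  by rewrite lt0r normc_ge0 andbT; apply: contra k0 => /eqP/eq0_normc ->.
have := le_Z k^-1 (k *: f).
by rewrite scalerA mulVf// scale1r normcV mulrC ler_pdivlMr// mulrC.
Qed.

Lemma ell_normMn (f : ty) m : ell_norm (f *+ m) = ell_norm f *+ m.
Proof.
rewrite -scaler_nat ell_normZ -[RHS]mulr_natl; congr (_ * _).
by rewrite (normcMn 1 m) normc1.
Qed.

Lemma ell_normN (f : ty) : ell_norm (- f) = ell_norm f.
Proof. by rewrite -scaleN1r ell_normZ normcN normc1 mul1r. Qed.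

HB.instance Definition _ := Num.Zmodule_isNormed.Build R ty
  ell_normD ell_norm0_eq0 ell_normMn ell_normN.
HB.instance Definition _ := PseudoMetric.copy ty (pseudoMetric_normed ty).
HB.instance Definition _ := isPointed.Build ty 0.
HB.instance Definition _ := NormedZmod_PseudoMetric_eq.Build R ty erefl.

Lemma ell_normrZ k (f : ty) : `|k *: f| = normc k * `|f|.
Proof. exact: ell_normZ. Qed.

End ell_theory.

Record bounded_op (R : realType) (p q : \bar R) (p1 : (1 <= p)%E)
    (q1 : (1 <= q)%E) (I J : choiceType) : Type := BoundedOp {
  op_fun :> {linear ell p1 I -> ell q1 J} ;
  op_bounded : exists M : R, forall c, `|op_fun c| <= M * `|c| }.

Section operators.
Context (R : realType) (p q : \bar R) (p1 : (1 <= p)%E) (q1 : (1 <= q)%E).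
Context (I J : choiceType).
Local Notation U := (ell p1 I).
Local Notation V := (ell q1 J).
Local Notation LUV := (bounded_op p1 q1 I J).
Local Notation LVU := (bounded_op q1 p1 J I).

(* The set is bounded above; it is empty, with sup = 0, only when U = 0. *)
Definition op_norm (A : LUV) : R :=
  sup [set `|A c| / `|c| | c in [set c : U | c != 0]].

Definition op_invertible (A : LUV) : Prop :=
  exists B : LVU, cancel A B /\ cancel B A.

Lemma scale_op_bounded (k : R[i]) (A : LUV) :
  exists M : R, forall c, `|(k \*: A) c| <= M * `|c|.
Proof.
case: (op_bounded A) => M AM; exists (normc k * M) => c.
by rewrite /= ell_normrZ -mulrA ler_wpM2l ?normc_ge0.
Qed.

Definition scale_op (k : R[i]) (A : LUV) : LUV :=
  BoundedOp (scale_op_bounded k A).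

Definition opmx_apply m l (M : 'M[LUV]_(m, l)) (v : 'cV[U]_l) : 'cV[V]_m :=
  \col_k \sum_i M k i (v i 0).

Definition norm_p1 m (v : 'cV[U]_m) : R := \sum_i `|v i 0|.

End operators.

Definition opmx_inverse (R : realType) (p q : \bar R) (p1 : (1 <= p)%E)
    (q1 : (1 <= q)%E) (I J : choiceType) m
    (M : 'M[bounded_op p1 q1 I J]_m) (N : 'M[bounded_op q1 p1 J I]_m) : Prop :=
  cancel (opmx_apply M) (opmx_apply N) /\ cancel (opmx_apply N) (opmx_apply M).

Lemma mem_ell_finite (R : realType) (p : \bar R) (I : finType) (f : I -> R[i]) :
  f \in @mem_ell R p I.
Proof.
rewrite inE; case: p => [r| |] /=; last by rewrite ltry.
  rewrite poweR_lty// esum_fset.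
  - by rewrite fsbig_finite//= sumEFin ltry.
  - exact: finite_finset.
  - by move=> i _; rewrite lee_fin powR_ge0.
pose M := \sum_i normc (f i).
have fM : (ereal_sup ([set 0%E] `|` [set (normc (f i))%:E | i in [set: I]])
             <= M%:E)%E.
  apply: ge_ereal_sup => _ [->|[i _ <-]]; rewrite lee_fin.
    by apply: sumr_ge0 => i _; exact: normc_ge0.
  rewrite /M (bigD1 i)//= lerDl; apply: sumr_ge0 => j _; exact: normc_ge0.
exact: le_lt_trans fM (ltry _).
Qed.

(* By mem_ell_finite, ell p1 'I_n is C^n with the p-norm. *)
Definition Bindex (R : realType) (p : \bar R) (n : nat) : choiceType :=
  if p == 2%:E then (nat : choiceType) else ('I_n : choiceType).

Definition Bspace (R : realType) (p : \bar R) (p1 : (1 <= p)%E) (n : nat) :=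
  ell p1 (Bindex p n).

Definition LB (R : realType) (p q : \bar R) (p1 : (1 <= p)%E) (q1 : (1 <= q)%E)
    (n : nat) :=
  bounded_op p1 q1 (Bindex p n) (Bindex q n).

Definition gram (X T : Type) (K : X -> X -> T) m (x : 'I_m -> X) : 'M[T]_m :=
  \matrix_(k, i) K (x i) (x k).

Definition kernel_col (X T : Type) (K : X -> X -> T) m (x : 'I_m -> X) (y : X) :
  'cV[T]_m := \col_i K y (x i).

Definition init_pts (X : Type) m (x : 'I_m.+1 -> X) : 'I_m -> X :=
  fun i => x (widen_ord (leqnSn m) i).

Record admissible_scalar (R : realType) (X : Type) (K : X -> X -> R[i]) : Prop :=
{ scalar_A1 : forall m (x : 'I_m -> X), injective x -> gram K x \in unitmx ;
  scalar_A2 : exists kappa : R, forall x y, normc (K x y) <= kappa ;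
  scalar_A3_finite : forall m (x : 'I_m -> X) (c : 'I_m -> R[i]),
    injective x ->
    (forall y, \sum_i c i * K (x i) y = 0) ->
    forall i, c i = 0 ;
  scalar_A3_countable : forall (x : nat -> X) (c : nat -> R[i]),
    injective x ->
    (\sum_(0 <= i <oo) (normc (c i))%:E < +oo)%E ->
    (forall y, series (fun i => c i * K (x i) y : R[i]^o) @ \oo
                 --> (0 : R[i]^o)) ->
    forall i, c i = 0 ;
  scalar_A4 : forall m (x : 'I_m.+1 -> X), injective x ->
    \sum_i normc ((invmx (gram K (init_pts x)) *m
                   kernel_col K (init_pts x) (x ord_max)) i 0) <= 1 }.

(* In op_A4 the matrix N is K[x]^-1, which exists by op_A1 and is unique. *)
Record admissible (R : realType) (p q : \bar R) (p1 : (1 <= p)%E)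
    (q1 : (1 <= q)%E) (n : nat) (X : Type) (K : X -> X -> LB p1 q1 n) : Prop :=
{ op_A1 : forall m (x : 'I_m -> X), injective x ->
    exists N : 'M[LB q1 p1 n]_m, opmx_inverse (gram K x) N ;
  op_A2 : exists2 kappa : R, 0 < kappa & forall x y, op_norm (K x y) <= kappa ;
  op_A3_finite : forall m (x : 'I_m -> X) (c : 'I_m -> Bspace p1 n),
    injective x ->
    (forall y, \sum_i K (x i) y (c i) = 0) ->
    forall i, c i = 0 ;
  op_A3_countable : forall (x : nat -> X) (c : nat -> Bspace p1 n),
    injective x ->
    (\sum_(0 <= i <oo) (`|c i|)%:E < +oo)%E ->
    (forall y, series (fun i => K (x i) y (c i)) @ \oo
                 --> (0 : Bspace q1 n)) ->
    forall i, c i = 0 ;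
  op_A4 : forall m (x : 'I_m.+1 -> X), injective x ->
    forall N : 'M[LB q1 p1 n]_m, opmx_inverse (gram K (init_pts x)) N ->
    (ereal_sup [set (norm_p1 (opmx_apply N (opmx_apply
                       (kernel_col K (init_pts x) (x ord_max)) (const_mx c)))
                     / `|c|)%R%:E
               | c in [set c : Bspace p1 n | c != 0%R]] <= 1)%E }.

(* Main.v *)
Require Import Defs.
From mathcomp Require Import all_boot all_order all_algebra.
From mathcomp Require Import complex.
From mathcomp Require Import all_classical all_reals all_analysis.

(* Let B be the inverse of A. If G is the scalar Gram matrix, the operator one is
   G tensor A, with inverse G^-1 tensor B; applied to the column K_x(y) A c it
   gives the vector (w_i c)_i where w = G^-1 K_x(y), so A disappears from (A4).
   For (A3), applying B to the series sum_i K(x_i, y) A c_i shows that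
   sum_i K(x_i, y) c_i = 0, and each coordinate of the c_i, being dominated by
   the norm, is handled by the scalar (A3'). *)

Set Implicit Arguments.
Unset Strict Implicit.
Unset Printing Implicit Defensive.

Import Order.TTheory GRing.Theory Num.Theory.
Import ComplexField.Normc.
Import numFieldNormedType.Exports.

Local Open Scope classical_set_scope.
Local Open Scope complex_scope.
Local Open Scope ring_scope.

Section ell_coordinates.
Context (R : realType) (p : \bar R) (p1 : (1 <= p)%E) (I : choiceType).
Implicit Types f g : ell p1 I.

Lemma normc_coord_le f i : normc (f i) <= `|f|.
Proof. by rewrite -lee_fin [leRHS]ell_normE; exact: le_lp_norm. Qed.

Lemma ell_sumE (T : Type) (s : seq T) (P : pred T) (F : T -> ell p1 I) i :
  (\sum_(j <- s | P j) F j) i = \sum_(j <- s | P j) F j i.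
Proof. by elim/big_rec2: _ => // j y1 y2 _ <-. Qed.

Lemma ell_eq0 f : (forall i, f i = 0) -> f = 0.
Proof. by move=> f0; apply/val_inj/funext => i; exact: f0. Qed.

Lemma cvg0_coord (u : nat -> ell p1 I) i :
  u @ \oo --> (0 : ell p1 I) -> (fun k => u k i : R[i]^o) @ \oo --> (0 : R[i]^o).
Proof.
move=> /cvgr0Pnorm_lt u0; apply/cvgr0Pnorm_lt => e e0.
(* The norm on [R[i]^o] takes values in [R[i]], so [e] is a positive complex number; being real, it
   is replaced by its real part to compare with norms in [R]. *)
have eE : e = (complex.Re e)%:C by rewrite RRe_real// gtr0_real.
have {}e0 : 0 < complex.Re e by rewrite -ltcR -eE.
near=> k; rewrite eE normc_def ltcR.
apply: le_lt_trans (_ : normc (u k i) < _).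
  by case: (u k i).
by apply: le_lt_trans (normc_coord_le _ _) _; near: k; exact: u0.
Unshelve. all: by end_near. Qed.

End ell_coordinates.

Section bounded_operators.
Context (R : realType) (p q : \bar R) (p1 : (1 <= p)%E) (q1 : (1 <= q)%E).
Context (I J : choiceType) (A : bounded_op p1 q1 I J).

Lemma scale_opE k c : scale_op k A c = k *: A c.
Proof. by []. Qed.

(** Enlarging a bound [M] to [|M| + 1] makes it strictly positive: it can then be divided by, and it
    yields the positive constant of (A2). *)
Lemma op_bounded_gt0 : exists2 M : R, 0 < M & forall c, `|A c| <= M * `|c|.
Proof.
have [M AM] := op_bounded A; exists (`|M| + 1); first by rewrite ltr_wpDl.
move=> c; apply: le_trans (AM c) _; rewrite ler_wpM2r//.
by apply: le_trans (ler_norm M) _; rewrite lerDl.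
Qed.

Lemma op_cvg0 (u : nat -> ell p1 I) :
  u @ \oo --> (0 : ell p1 I) -> (A \o u) @ \oo --> (0 : ell q1 J).
Proof.
have [M M0 AM] := op_bounded_gt0.
move=> /cvgr0Pnorm_lt u0; apply/cvgr0Pnorm_lt => e e0.
near=> k; apply: le_lt_trans (AM _) _; rewrite mulrC -ltr_pdivlMr//.
by near: k; apply: u0; rewrite divr_gt0.
Unshelve. all: by end_near. Qed.

Lemma op_norm_le M : 0 <= M -> (forall c, `|A c| <= M * `|c|) -> op_norm A <= M.
Proof.
move=> M0 AM; rewrite /op_norm; set S := [set _ | _ in _].
(* On a zero domain the set is empty and its [sup] is 0, whence the hypothesis [0 <= M]. *)
have [->|S0] := eqVneq S set0; first by rewrite sup0.
apply: ge_sup; first exact/set0P.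
by move=> _ [c /= c0 <-]; rewrite ler_pdivrMr ?normr_gt0.
Qed.

End bounded_operators.

Section tensor.
Context (R : realType) (p q : \bar R) (p1 : (1 <= p)%E) (q1 : (1 <= q)%E).
Context (I J : choiceType) (A : bounded_op p1 q1 I J).

(** The Kronecker product of [G] and [A], rectangular so as to cover both Gram matrices and kernel
    columns. *)
Definition tensor_mx m l (G : 'M[R[i]]_(m, l)) : 'M[bounded_op p1 q1 I J]_(m, l) :=
  \matrix_(i, j) scale_op (G i j) A.

(** Linearity moves [A] outside the sum, where an inverse of [A] can cancel it. *)
Lemma opmx_apply_tensor m l (G : 'M[R[i]]_(m, l)) v i :
  opmx_apply (tensor_mx G) v i 0 = A (\sum_j G i j *: v j 0).
Proof.
rewrite mxE linear_sum; apply: eq_bigr => j _.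
by rewrite mxE scale_opE linearZ.
Qed.

Lemma gram_tensor (X : Type) (K : X -> X -> R[i]) m (x : 'I_m -> X) :
  gram (fun x x' => scale_op (K x x') A) x = tensor_mx (gram K x).
Proof. by apply/matrixP => i j; rewrite !mxE. Qed.

Lemma kernel_col_tensor (X : Type) (K : X -> X -> R[i]) m (x : 'I_m -> X) y :
  kernel_col (fun x x' => scale_op (K x x') A) x y = tensor_mx (kernel_col K x y).
Proof. by apply/matrixP => i j; rewrite !mxE. Qed.

End tensor.

Lemma mulmx_scale (R : comPzRingType) (V : lmodType R) m k l (F : 'M[R]_(m, k))
    (G : 'M[R]_(k, l)) (v : 'I_l -> V) i :
  \sum_j F i j *: (\sum_h G j h *: v h) = \sum_h (F *m G) i h *: v h.
Proof.
under eq_bigr do rewrite scaler_sumr.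
rewrite exchange_big; apply: eq_bigr => h _.
by rewrite mxE scaler_suml; apply: eq_bigr => j _; rewrite scalerA.
Qed.

(** The product of the two tensors is [F *m G] tensor [B \o A], the identity. Only one side is
    treated, so that exchanging roles gives the other. *)
Lemma tensor_mxK (R : realType) (p q : \bar R) (p1 : (1 <= p)%E)
    (q1 : (1 <= q)%E) (I J : choiceType) (A : bounded_op p1 q1 I J)
    (B : bounded_op q1 p1 J I) m (F G : 'M[R[i]]_m) : cancel A B -> F *m G = 1%:M ->
  cancel (opmx_apply (tensor_mx A G)) (opmx_apply (tensor_mx B F)).
Proof.
move=> AK FG v; apply/colP => i; rewrite opmx_apply_tensor linear_sum.
under eq_bigr do rewrite opmx_apply_tensor linearZ /= AK.
rewrite mulmx_scale FG (bigD1 i)//= big1 ?addr0; first by rewrite mxE eqxx scale1r.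
by move=> j ji; rewrite mxE eq_sym (negPf ji) scale0r.
Qed.

Section tensor_inverse.
Context (R : realType) (p q : \bar R) (p1 : (1 <= p)%E) (q1 : (1 <= q)%E).
Context (I J : choiceType).

Lemma tensor_mx_inverse (A : bounded_op p1 q1 I J) (B : bounded_op q1 p1 J I) m
    (G : 'M[R[i]]_m) : cancel A B -> cancel B A -> G \in unitmx ->
  opmx_inverse (tensor_mx A G) (tensor_mx B (invmx G)).
Proof.
by move=> AK BK Gu; split; apply: tensor_mxK; rewrite ?mulVmx ?mulmxV.
Qed.

Lemma opmx_inverse_tensor_col (A : bounded_op p1 q1 I J) m (G : 'M[R[i]]_m)
    (N : 'M[bounded_op q1 p1 J I]_m) (k : 'cV[R[i]]_m) c :
  G \in unitmx -> opmx_inverse (tensor_mx A G) N ->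
  opmx_apply N (opmx_apply (tensor_mx A k) (const_mx c)) =
  \col_i ((invmx G *m k) i 0 *: c).
Proof.
(* As [N] undoes [tensor_mx A G], it suffices to compare the arguments of [N]: with
   [w = invmx G *m k], both are [k i 0 *: c] under [A], because [G *m w = k]. *)
move=> Gu [NK _]; rewrite -[RHS]NK; congr opmx_apply; apply/colP => i.
rewrite !opmx_apply_tensor big_ord1 [const_mx _ _ _]mxE; congr (A _).
under eq_bigr do rewrite [(\col__ _) _ _]mxE scalerA.
by rewrite -scaler_suml -[k in LHS](mulKVmx Gu k) [(G *m _) _ _]mxE.
Qed.

End tensor_inverse.

Theorem theorem5p5 (R : realType) (p q : \bar R)
    (p1 : (1 <= p)%E) (q1 : (1 <= q)%E) (pq : (p^-1 + q^-1 = 1)%E)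
    (n : nat) (X : Type) (X0 : inhabited X)
    (K : X -> X -> R[i]) (A : LB p1 q1 n) :
  admissible_scalar K -> op_invertible A ->
  admissible (fun x x' => scale_op (K x x') A).
Proof.
move=> [K1 [kappa K2] K3f K3c K4] [B [AK BK]]; split.
- move=> m x /K1 Gu; exists (tensor_mx B (invmx (gram K x))).
  by rewrite gram_tensor; exact: tensor_mx_inverse.
- have [M M0 AM] := op_bounded_gt0 A.
  have k1 : 0 < `|kappa| + 1 by rewrite ltr_wpDl.
  (* The scalar bound [kappa] may vanish, hence the added 1. *)
  exists ((`|kappa| + 1) * M); first exact: mulr_gt0.
  move=> x y; apply: op_norm_le => [|c]; first by rewrite mulr_ge0 ?ltW.
  rewrite scale_opE ell_normrZ -mulrA ler_pM ?normc_ge0//.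
  by rewrite (le_trans (K2 x y))// (le_trans (ler_norm _))// lerDl.
- move=> m x c xI Kc0 i; apply: ell_eq0 => j.
  apply: (K3f m x (fun i => c i j)) => // y.
  have /(congr1 (fun f : ell p1 _ => f j)) : \sum_i K (x i) y *: c i = 0.
    rewrite -[LHS]AK linear_sum.
    by under eq_bigr do rewrite linearZ; rewrite [X in B X]Kc0 linear0.
  rewrite ell_sumE => Kcj; rewrite -[RHS]Kcj.
  by apply: eq_bigr => k _; rewrite mulrC.
- move=> x c xI cfin Kc0 i; apply: ell_eq0 => j.
  apply: (K3c x (fun i => c i j)) => // [|y].
    apply: le_lt_trans cfin; apply: lee_nneseries => k *.
      by rewrite lee_fin normc_ge0.
    by rewrite lee_fin normc_coord_le.
  (* Each scalar partial sum equals the [j]-th coordinate of [B] applied to the operator partial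
     sum; [B] is continuous, so the limit is 0. *)
  apply: cvg_trans (cvg0_coord j (op_cvg0 B (Kc0 y))).
  apply: near_eq_cvg; apply: nearW => k.
  rewrite /series /= linear_sum ell_sumE; apply: eq_bigr => l _.
  by rewrite linearZ /= AK mulrC.
- move=> m x xI N; rewrite gram_tensor kernel_col_tensor => NK.
  have Gu : gram K (init_pts x) \in unitmx.
    by apply: K1 => i j /xI /(congr1 val) ij; exact/val_inj.
  apply: ge_ereal_sup => _ [c /= c0 <-].
  rewrite (opmx_inverse_tensor_col _ _ Gu NK) lee_fin ler_pdivrMr ?normr_gt0//.
  rewrite /norm_p1; under eq_bigr do rewrite mxE ell_normrZ.
  (* The norm of [c] factors out of the sum, leaving the scalar sum of (A4'). *)
  by rewrite -mulr_suml ler_wpM2r// K4.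
Qed.
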